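(* Let $(X,<)$ be a dense linear order and $S\subseteq X$. If $S\not\rightarrow(\omega^* )_\omega^1$, i.e., $S$ is a union of countably many subsets each of which is well-ordered by $<$, then Player II has a winning strategy in the game $BG(X,S)$. In particular, if $S$ is countable, then Player II has a winning strategy in $BG(X,S)$.
   Context: For a linearly ordered set $S$, the symbol $S\not\rightarrow(\omega^* )_\omega^1$ abbreviates the statement that $S$ is a countable union of well-ordered sets (with respect to the induced order). Let $(X,<)$ be a dense linear order and $S\subseteq X$. The game $BG(X,S)$ is the following two-player game of perfect information of length $\omega$. Player I starts by picking $a_0\in X$, where $a_0$ is not the greatest element of $X$ (if $X$ has one). Then Player II picks $b_0\in X$ with $a_0<b_0$. In turn $n\geq 1$, Player I picks $a_n\in X$ with $a_{n-1}<a_n<b_{n-1}$, and then Player II picks $b_n\in X$ with $a_n<b_n<b_{n-1}$. Density ensures that there is always a legal move after the first one. After $\omega$-many turns, Player I wins if there is $x\in S$ such that $a_n<x<b_n$ for all $n<\omega$; otherwise Player II wins. *)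

(* Defs.v *)
From mathcomp Require Import all_boot all_order.
From mathcomp Require Import boolp classical_sets functions cardinality.
From mathcomp Require wochoice.

Set Implicit Arguments.
Unset Strict Implicit.
Unset Printing Implicit Defensive.

Local Open Scope classical_set_scope.
Local Open Scope order_scope.

Definition dense_order d (X : orderType d) : Prop :=
  forall x y : X, x < y -> exists z, x < z < y.

(* [S -/-> (omega^* )^1_omega]. Since [set0] is well-ordered, sequences
   [F : nat -> set X] also account for finite unions. *)
Definition sigma_well_ordered d (X : orderType d) (S : set X) : Prop :=
  exists F : nat -> set X,
    S = \bigcup_n F n /\
    forall n, wochoice.wo_chain (<=%O : rel X) [in F n].

Section BG.
Context d (X : orderType d).

(* A run of BG(X, S): [a n] and [b n] are the moves of I and II in turn [n]. *)
Implicit Types (a b : nat -> X) (n : nat) (S : set X).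

Definition legal_moveI a b n : Prop :=
  if n is m.+1 then a m < a n < b m else ~ (forall x, x <= a 0%N).

Definition legal_moveII a b n : Prop :=
  if n is m.+1 then a n < b n < b m else a 0%N < b 0%N.

Definition playerI_wins S a b : Prop :=
  exists2 x, S x & forall n, a n < x < b n.

(* II's move, as a function of the list of previous rounds (in order of play)
   and of I's move in the current turn. *)
Definition strategyII := seq (X * X) -> X -> X.

Definition follows (sigma : strategyII) a b : Prop :=
  forall n, b n = sigma (mkseq (fun i => (a i, b i)) n) (a n).

(* Legality of II's reply in turn [n] is required as soon as I has played
   legally up to turn [n], whatever the later terms of [a] are: the first
   clause thus covers every finite partial run. *)
Definition winning_strategyII S (sigma : strategyII) : Prop :=
  forall a b, follows sigma a b ->
    (forall n, (forall k, (k <= n)%N -> legal_moveI a b k) ->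
       legal_moveII a b n) /\
    ((forall n, legal_moveI a b n) -> ~ playerI_wins S a b).

Definition II_has_winning_strategy S : Prop :=
  exists sigma : strategyII, winning_strategyII S sigma.

End BG.

(* Main.v *)
Require Import Defs.
From mathcomp Require Import all_boot all_order.
From mathcomp Require Import boolp classical_sets functions cardinality.
From mathcomp Require wochoice.

(** Let [S] be the union of well-ordered sets [F n]. Player II spends turn [n]
on getting rid of [F n]: among the points that are legal replies to [a n], II
plays the least one that lies in [F n], or any legal point at all if [F n] has
none. Either way no point of [F n] lies strictly between [a n] and [b n], so no
point of [S] survives all turns. Legal points exist by density, and in turn
[0] because [a 0] is not the greatest element.

A countable set is a union of countably many sets with at most one point, and
those are well-ordered. *)

Set Implicit Arguments.
Unset Strict Implicit.
Unset Printing Implicit Defensive.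

Import Order.TTheory.

Local Open Scope classical_set_scope.
Local Open Scope order_scope.

Section WellOrderedPieces.
Context d (X : orderType d).
Implicit Types (A S : set X) (h : seq (X * X)).

Lemma wo_chain_exists_min A : wochoice.wo_chain (<=%O : rel X) [in A] ->
  forall B : set X, B `<=` A -> B !=set0 ->
    exists2 x, B x & forall y, B y -> x <= y.
Proof.
move=> woA B BA [x Bx].
have [||m [[mB m_min] _]] := woA [in B].
- by move=> y; rewrite !inE => /BA.
- by exists x; rewrite inE.
exists m; first by rewrite inE in mB.
by move=> y By; apply: m_min; rewrite inE.
Qed.

Lemma wo_chain_subsingleton A : (forall x y, A x -> A y -> x = y) ->
  wochoice.wo_chain (<=%O : rel X) [in A].
Proof.
move=> A1 B BA [x Bx].
have eqx y : y \in B -> y = x.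
  by move=> By; apply: A1; apply/set_mem; apply: BA.
exists x; split; first by split=> // y /eqx ->.
by move=> y [/eqx ->].
Qed.

Lemma countable_sigma_well_ordered S : countable S -> sigma_well_ordered S.
Proof.
move=> /countable_injP[f f_inj].
exists (fun n => [set x | S x /\ f x = n]); split.
  rewrite predeqE => x; split=> [Sx|[n _ []]//].
  by exists (f x).
move=> n; apply: wo_chain_subsingleton => x y [Sx fx] [Sy fy].
by apply: f_inj; rewrite ?inE ?fx ?fy.
Qed.

Definition legal_replies h (a : X) : set X :=
  [set z | a < z /\ (h <> [::] -> z < (last (a, a) h).2)].

Definition avoiding_replies (F : nat -> set X) h (a : X) : set X :=
  [set z | legal_replies h a z /\
           forall y, F (size h) y -> legal_replies h a y -> z <= y].

(** The length of the history is the number of the current turn, hence the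
index of the piece to be avoided. When the pieces are well-ordered, the default
value [a] is returned only if there is no legal reply. *)
Definition avoiding_strategy (F : nat -> set X) : strategyII X :=
  fun h a => xget a (avoiding_replies F h a).

(** The least point of the piece is itself a legal reply, and it bounds an open
interval that misses the piece. *)
Lemma avoiding_replies_neq0 (F : nat -> set X) h a :
  wochoice.wo_chain (<=%O : rel X) [in F (size h)] ->
  legal_replies h a !=set0 -> avoiding_replies F h a !=set0.
Proof.
move=> woF [z z_legal].
have [hit|miss] := pselect (F (size h) `&` legal_replies h a !=set0).
  have [x [_ x_legal] x_min] := wo_chain_exists_min woF (@subIsetl _ _ _) hit.
  by exists x; split=> // y Fy y_legal; apply: x_min.
by exists z; split=> // y Fy y_legal; case: miss; exists y.
Qed.

Lemma legal_repliesE (a b : nat -> X) n z :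
  legal_replies (mkseq (fun i => (a i, b i)) n) (a n) z <->
  a n < z /\ (if n is m.+1 then z < b m else True).
Proof.
rewrite /legal_replies /=; case: n => [|m]; first by split=> -[].
rewrite mkseqS last_rcons /=; split=> -[az zb]; split=> //.
by apply: zb; case: mkseq.
Qed.

Lemma legal_replies_neq0 (a b : nat -> X) n : dense_order X ->
  legal_moveI a b n ->
  legal_replies (mkseq (fun i => (a i, b i)) n) (a n) !=set0.
Proof.
move=> X_dense; case: n => [|m] /=.
  move=> /existsNP[z /negP]; rewrite -ltNge => az.
  by exists z; apply/legal_repliesE.
move=> /andP[_ /X_dense[z /andP[az zb]]].
by exists z; apply/legal_repliesE.
Qed.

Lemma avoiding_strategy_wins (F : nat -> set X) : dense_order X ->
  (forall n, wochoice.wo_chain (<=%O : rel X) [in F n]) ->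
  winning_strategyII (\bigcup_n F n) (avoiding_strategy F).
Proof.
move=> X_dense woF a b b_follows.
have reply n : legal_moveI a b n ->
    avoiding_replies F (mkseq (fun i => (a i, b i)) n) (a n) (b n).
  move=> /(legal_replies_neq0 X_dense)/(avoiding_replies_neq0 (woF _)) replies.
  by rewrite [b n]b_follows; apply: xgetPex replies.
split=> [n legal|legal [x [n _ Fx] x_between]].
  have [/legal_repliesE bn _] := reply n (legal n (leqnn n)).
  by case: n bn {legal} => [[]|m [? ?]] //; apply/andP.
have x_legal : legal_replies (mkseq (fun i => (a i, b i)) n) (a n) x.
  apply/legal_repliesE; split; first by have /andP[] := x_between n.
  by case: n {Fx} => // m; have /andP[] := x_between m.
have [_] := reply n (legal n); rewrite size_mkseq => /(_ x Fx x_legal).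
by have /andP[_ xb] := x_between n; rewrite leNgt xb.
Qed.

End WellOrderedPieces.

Theorem proposition3p1 (d : Order.disp_t) (X : orderType d) (S : set X)
    (X_dense : dense_order X) :
  (sigma_well_ordered S -> II_has_winning_strategy S) /\
  (countable S -> II_has_winning_strategy S).
Proof.
have sigma_case : sigma_well_ordered S -> II_has_winning_strategy S.
  move=> [F [-> woF]]; exists (avoiding_strategy F).
  exact: avoiding_strategy_wins.
by split=> // /countable_sigma_well_ordered.
Qed.
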